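(* Let $X$ be a uniformly convex real Banach space and let $\alpha_*,\alpha^*$ be constants with $0<\alpha_*<\alpha^*<1$. Suppose that $\{\alpha_{in}\}_{n=1}^\infty\subset[\alpha_*,\alpha^*]$, $i=1,\dots,m$, are sequences with $\sum_{i=1}^m\alpha_{in}=1$ for all $n\in\mathbb{N}$. Suppose $\{z_{in}\}_{n=1}^\infty$, $i=1,\dots,m$, are sequences in $X$ such that for some $d\ge0$ $$\lim_{n\to\infty}\left\|\sum_{i=1}^m\alpha_{in}z_{in}\right\|=d,\qquad \limsup_{n\to\infty}\|z_{in}\|\le d\quad\text{for all } i=1,\dots,m.$$ Then $\lim_{n\to\infty}\|z_{in}\|=d$ and $\lim_{n\to\infty}\|z_{in}-z_{jn}\|=0$ for all $i,j\in\{1,\dots,m\}$. *)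

(* Defs.v *)
From HB Require Import structures.
From mathcomp Require Import all_boot all_order all_algebra.
From mathcomp Require Import all_classical all_reals all_analysis.

Set Implicit Arguments.
Unset Strict Implicit.
Unset Printing Implicit Defensive.

Import Order.TTheory GRing.Theory Num.Theory.
Import numFieldNormedType.Exports.

Local Open Scope ring_scope.

(* Clarkson's definition, with x and y on the unit sphere. *)
Definition uniformly_convex (R : realType) (X : normedModType R) : Prop :=
  forall eps : R, 0 < eps <= 2 ->
    exists2 delta : R, 0 < delta &
      forall x y : X, `|x| = 1 -> `|y| = 1 -> eps <= `|x - y| ->
        `|2^-1 *: (x + y)| <= 1 - delta.

(* Main.v *)
(* Every weight is at least a = alpha_lo, so the convex combination can be
   rewritten as a times the midpoint of z_i and z_j plus nonnegative weights of
   total 1 - a on vectors of norm at most d + e. Its norm tending to d therefore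
   forces the norm of the midpoint up to d for every pair i, j. The case i = j
   gives |z_i| -> d, and uniform convexity, after normalising z_i and z_j, gives
   |z_i - z_j| -> 0. *)

Require Import Defs.
From HB Require Import structures.
From mathcomp Require Import all_boot all_order all_algebra.
From mathcomp Require Import all_classical all_reals all_analysis.
From mathcomp Require Import lra.

Set Implicit Arguments.
Unset Strict Implicit.
Unset Printing Implicit Defensive.

Import Order.TTheory GRing.Theory Num.Theory.
Import numFieldNormedType.Exports.

Local Open Scope classical_set_scope.
Local Open Scope ring_scope.

(** The limsup is an infimum of suprema over neighbourhoods of infinity, so one of these suprema is
    already below [b]. *)
Lemma limn_esup_near_lt (R : realType) (u : (\bar R)^nat) (b : \bar R) :
  (limn_esup u < b)%E -> \forall n \near \oo, (u n < b)%E.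
Proof.
rewrite /limn_esup limf_esupE => /ereal_inf_lt[_ [V V_oo <-] supVb].
apply: filterS V_oo => n Vn; apply: le_lt_trans supVb.
by apply: ereal_sup_ubound; exists n.
Qed.

(* Half of the weight a is moved from w i and from w j to their midpoint; the
   remaining weights c k stay nonnegative, also when i = j. *)
Lemma norm_convex_sum_le_midpoint (R : realType) (X : normedModType R) (m : nat)
    (c : 'I_m -> R) (w : 'I_m -> X) (a b : R) (i j : 'I_m) :
  0 <= a -> (forall k, a <= c k) -> \sum_(k < m) c k = 1 ->
  (forall k, `|w k| <= b) ->
  `|\sum_(k < m) c k *: w k| <= a * `|2^-1 *: (w i + w j)| + (1 - a) * b.
Proof.
move=> a0 ac c1 wb.
pose e k : R := a / 2 * ((k == i)%:R + (k == j)%:R).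
have sum_delta k : \sum_l (l == k)%:R = 1 :> R.
  by rewrite (bigD1 k)//= eqxx big1 ?addr0// => l /negbTE ->.
have sum_deltaw k : \sum_l (l == k)%:R *: w l = w k.
  rewrite (bigD1 k)//= eqxx scale1r big1 ?addr0// => l /negbTE ->.
  by rewrite scale0r.
have sum_e : \sum_k e k = a.
  by rewrite -mulr_sumr big_split /= !sum_delta; lra.
have sum_ew : \sum_k e k *: w k = a *: (2^-1 *: (w i + w j)).
  under eq_bigr do rewrite /e -scalerA scalerDl.
  by rewrite -scaler_sumr big_split /= !sum_deltaw scalerA.
have ec k : e k <= c k.
  apply: le_trans (ac k); rewrite /e.
  by case: (k == i); case: (k == j) => /=; lra.
have -> : \sum_k c k *: w k = \sum_k e k *: w k + \sum_k (c k - e k) *: w k.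
  by rewrite -big_split /=; apply: eq_bigr => k _; rewrite -scalerDl subrKC.
rewrite sum_ew (le_trans (ler_normD _ _))// lerD ?normrZ ?(ger0_norm a0)//.
have -> : 1 - a = \sum_k (c k - e k) by rewrite sumrB c1 sum_e.
rewrite mulr_suml (le_trans (ler_norm_sum _ _ _))//.
apply: ler_sum => k _; rewrite normrZ ger0_norm ?subr_ge0//.
by rewrite ler_wpM2l ?subr_ge0.
Qed.

(** Moves Clarkson's condition to a thin shell around the sphere of radius [d]: projecting [u] and
    [v] radially onto that sphere costs at most [eta] each. As [eta] is uniform in [u] and [v], the
    bound applies along sequences. *)
Lemma uniformly_convex_near_sphere (R : realType) (X : normedModType R)
    (d eps : R) :
  uniformly_convex X -> 0 <= d -> 0 < eps ->
  exists2 eta : R, 0 < eta & forall u v : X,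
    `|d - `|u| | <= eta -> `|d - `|v| | <= eta ->
    d - eta <= `|2^-1 *: (u + v)| -> `|u - v| <= eps.
Proof.
move=> Xuc; rewrite le_eqVlt => /predU1P[<- eps0|d0 eps0].
  (* For [d = 0] nothing can be normalised, but two norms of at most [eps / 2] suffice. *)
  exists (eps / 2) => [|u v]; first lra.
  rewrite !sub0r !normrN !normr_id => u_small v_small _.
  by have := ler_normB u v; lra.
(* Only half of [eps / d] is asked for, to absorb the projection errors; the cap 2 is the range in
   [uniformly_convex]. *)
pose e := Num.min (eps / (2 * d)) 2.
have e_itv : 0 < e <= 2.
  by rewrite lt_min ge_min lexx orbT ltr0n !andbT divr_gt0 ?mulr_gt0.
have [delta delta0 mid_le] := Xuc _ e_itv.
(* The bound [d / 2] keeps [u] and [v] nonzero; [eps / 5] gives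
   [d * |x - y| > eps - 2 * eta >= eps / 2]; [d * delta / 3] contradicts the final inequality
   [d - eta <= d * (1 - delta) + eta]. *)
pose eta := Num.min (d / 2) (Num.min (eps / 5) (d * delta / 3)).
have eta0 : 0 < eta by rewrite !lt_min !divr_gt0 ?mulr_gt0.
have eta_d : eta <= d / 2 by rewrite ge_min lexx.
have eta_eps : eta <= eps / 5 by rewrite !ge_min lexx orbT.
have eta_delta : eta <= d * delta / 3 by rewrite !ge_min lexx !orbT.
exists eta => // u v u_d v_d mid_d; rewrite leNgt; apply/negP => uv_eps.
pose unit_of (w : X) := `|w|^-1 *: w.
have unit1 w : `|d - `|w| | <= eta -> `|unit_of w| = 1.
  move=> w_d; rewrite normrZ normfV normr_id mulVf// gt_eqF//.
  by move: w_d; rewrite ler_norml => /andP[]; lra.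
have unit_d w : `|d - `|w| | <= eta -> `|d *: unit_of w - w| <= eta.
  move=> w_d; have w0 : `|w| != 0.
    rewrite gt_eqF//.
    by move: w_d; rewrite ler_norml => /andP[]; lra.
  have -> : d *: unit_of w - w = (d - `|w|) *: unit_of w.
    by rewrite scalerBl /unit_of (scalerA `|w|) mulfV// scale1r.
  by rewrite normrZ unit1// mulr1.
have := mid_le (unit_of u) (unit_of v) (unit1 u u_d) (unit1 v v_d).
have := unit_d u u_d; have := unit_d v v_d.
set x := unit_of u; set y := unit_of v => y_v x_u mid_xy.
have xy_dist : `|u - v| <= d * `|x - y| + 2 * eta.
  have := ler_distD (d *: x) u v; have := ler_distD (d *: y) (d *: x) v.
  by rewrite -scalerBr normrZ (gtr0_norm d0) (distrC u (d *: x)); lra.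
have xy_mid : `|2^-1 *: (u + v)| <= d * `|2^-1 *: (x + y)| + eta.
  have := lerB_dist (u + v) (d *: (x + y)).
  rewrite scalerDr opprD addrACA -scalerDr !normrZ (gtr0_norm d0).
  rewrite gtr0_norm ?invr_gt0//.
  have := ler_normD (u - d *: x) (v - d *: y).
  by rewrite distrC in x_u; rewrite distrC in y_v; lra.
have e_xy : e <= `|x - y|.
  rewrite ge_min; apply/orP; left.
  rewrite ler_pdivrMr ?mulr_gt0//; lra.
have := mid_xy e_xy; rewrite -(ler_pM2l d0) mulrBr mulr1; nra.
Qed.

Theorem lemma3p2 (R : realType) (X : completeNormedModType R)
  (Xuc : uniformly_convex X)
  (alpha_lo alpha_hi : R)
  (halpha : 0 < alpha_lo /\ alpha_lo < alpha_hi /\ alpha_hi < 1)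
  (m : nat) (alpha : 'I_m -> nat -> R)
  (alpha_itv : forall (i : 'I_m) (n : nat),
     alpha_lo <= alpha i n /\ alpha i n <= alpha_hi)
  (alpha_sum : forall n : nat, \sum_(i < m) alpha i n = 1)
  (z : 'I_m -> nat -> X) (d : R) (d_ge0 : 0 <= d)
  (z_sum : `|\sum_(i < m) alpha i n *: z i n| @[n --> \oo] --> d)
  (z_limsup : forall i : 'I_m,
     (limn_esup (fun n : nat => (`|z i n|)%:E) <= d%:E)%E) :
  (forall i : 'I_m, `|z i n| @[n --> \oo] --> d) /\
  (forall i j : 'I_m, `|z i n - z j n| @[n --> \oo] --> (0 : R)).
Proof.
have [a0 [_ _]] := halpha.
have mid (i j : 'I_m) (eta : R) : 0 < eta ->
    \forall n \near \oo, d - eta <= `|2^-1 *: (z i n + z j n)|.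
  (* With [M] the norm of the midpoint, [d - e <= alpha_lo * M + (1 - alpha_lo) * (d + e)] gives
     [alpha_lo * M >= alpha_lo * d - 2 * e + alpha_lo * e], and [2 * e = alpha_lo * eta]. *)
  move=> eta0; pose e := alpha_lo * eta / 2.
  have e0 : 0 < e by rewrite divr_gt0 ?mulr_gt0.
  have z_le : \forall n \near \oo, forall k, `|z k n| <= d + e.
    (* There are finitely many indices, so one tail serves all [k]. *)
    apply: filter_forall => k.
    have /limn_esup_near_lt : (limn_esup (fun n => (`|z k n|)%:E) < (d + e)%:E)%E.
      by rewrite (le_lt_trans (z_limsup k))// lte_fin ltrDl.
    by apply: filterS => n; rewrite lte_fin => /ltW.
  near=> n.
  have sum_ge : d - e <= `|\sum_(k < m) alpha k n *: z k n|.
    have : `|d - `|\sum_(k < m) alpha k n *: z k n| | <= e.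
      by near: n; exact: cvgr_dist_le z_sum _ e0.
    by rewrite ler_norml => /andP[_]; lra.
  have zn_le k : `|z k n| <= d + e by move: k; near: n.
  have := norm_convex_sum_le_midpoint i j (ltW a0)
    (fun k => (alpha_itv k n).1) (alpha_sum n) zn_le.
  rewrite -[d - eta <= _](ler_pM2l a0) => sum_le.
  have ae0 := mulr_gt0 a0 e0.
  have eE : 2 * e = alpha_lo * eta by rewrite /e; lra.
  lra.
have norm_cvg i : `|z i n| @[n --> \oo] --> d.
  apply/cvgrPdist_le => eps eps0; near=> n; rewrite ler_norml.
  have : d - eps <= `|z i n|.
    (* [z i n] is its own midpoint, so [mid] with [j = i] is the lower bound. *)
    have -> : z i n = 2^-1 *: (z i n + z i n).
      by rewrite scalerDr -scalerDl -[2^-1]mul1r -splitr scale1r.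
    by near: n; exact: mid.
  have : `|z i n| <= d + eps.
    apply: ltW; rewrite -lte_fin; near: n; apply: limn_esup_near_lt.
    by rewrite (le_lt_trans (z_limsup i))// lte_fin ltrDl.
  by move=> ? ?; apply/andP; split; lra.
split=> // i j; apply/cvgrPdist_le => eps eps0.
have [eta eta0 close] := uniformly_convex_near_sphere Xuc d_ge0 eps0.
near=> n; rewrite sub0r normrN normr_id; apply: close.
- by near: n; exact: cvgr_dist_le (norm_cvg i) _ eta0.
- by near: n; exact: cvgr_dist_le (norm_cvg j) _ eta0.
- by near: n; exact: mid.
Unshelve. all: by end_near. Qed.
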